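(* Let $V:\mathbb{R}^n\to\mathbb{R}$ be locally Lipschitz continuous, bounded below and coercive. Let $(x^k)_{k\in\mathbb{N}}$ be iterates produced by the randomised Itoh--Abe method for $V$ with starting point $x^0\in\mathbb{R}^n$, time steps $(\tau_k)_{k\in\mathbb{N}}\subset[\tau_{\min},\tau_{\max}]$, where $0<\tau_{\min}\leq\tau_{\max}<\infty$, and a (deterministic) sequence of directions $(d^k)_{k\in\mathbb{N}}\subset S^{n-1}$ that is cyclically dense in $S^{n-1}$. Then every accumulation point $x^*$ of $(x^k)_{k\in\mathbb{N}}$ satisfies $0\in\partial V(x^* )$, where $\partial V$ is the Clarke subdifferential.
   Context: $S^{n-1}=\{x\in\mathbb{R}^n:\|x\|=1\}$ with the Euclidean norm, and $B_\varepsilon(x)$ is the open ball of radius $\varepsilon$ about $x$. $V$ is coercive if $\{x\in\mathbb{R}^n: V(x)\leq M\}$ is compact for every $M\in\mathbb{R}$. The Clarke directional derivative is $$V^o(x;d)=\limsup_{y\to x,\ \lambda\downarrow0}\frac{V(y+\lambda d)-V(y)}{\lambda},$$ and the Clarke subdifferential is $\partial V(x)=\{p\in\mathbb{R}^n: V^o(x;d)\geq\langle d,p\rangle\text{ for all }d\in\mathbb{R}^n\}$. A sequence $(d^k)_{k\in\mathbb{N}}\subset S^{n-1}$ is cyclically dense in $S^{n-1}$ if for all $\varepsilon>0$ there is $N\in\mathbb{N}$ such that for every $k\in\mathbb{N}$ the set $\{d^k,\ldots,d^{k+N-1}\}$ forms an $\varepsilon$-cover of $S^{n-1}$, i.e.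 $S^{n-1}\subset\bigcup_{i=k}^{k+N-1}B_\varepsilon(d^i)$. Randomised Itoh--Abe method: given $x^0\in\mathbb{R}^n$, directions $(d^k)_{k\in\mathbb{N}}\subset S^{n-1}$ and time steps $(\tau_k)_{k\in\mathbb{N}}$, at step $k=0,1,2,\ldots$ set $x^{k+1}=x^k-\tau_k\beta_k d^k$, where $\beta_k\neq0$ is a solution of $$\beta_k=-\frac{V(x^k-\tau_k\beta_k d^k)-V(x^k)}{\tau_k\beta_k};$$ if no such nonzero $\beta_k$ exists, set $x^{k+1}=x^k$. (If several solutions exist, any one of them may be taken.) *)

(* Defs.v *)
From HB Require Import structures.
From mathcomp Require Import all_boot all_order all_algebra.
From mathcomp Require Import all_classical all_reals all_analysis.

Set Implicit Arguments.
Unset Strict Implicit.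
Unset Printing Implicit Defensive.

Import Order.TTheory GRing.Theory Num.Theory.
Import numFieldNormedType.Exports.

Local Open Scope classical_set_scope.
Local Open Scope ring_scope.

(* R^n is 'rV[R]_n. Its library norm `|x| is the sup norm, so every metric
   notion below is stated with the Euclidean norm [enorm]; only the topology
   (nbhs, compact, cluster), which is the same for both, is the library's. *)

Definition dotmul (R : realType) (n : nat) (u v : 'rV[R]_n) : R :=
  \sum_(i < n) u 0 i * v 0 i.

Definition enorm (R : realType) (n : nat) (u : 'rV[R]_n) : R :=
  Num.sqrt (dotmul u u).

Definition eball (R : realType) (n : nat) (x : 'rV[R]_n) (e : R) :
    set 'rV[R]_n :=
  [set y | enorm (y - x) < e].

(* The sphere S^(n-1); it is empty when n = 0. *)
Definition esphere (R : realType) (n : nat) : set 'rV[R]_n :=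
  [set x | enorm x = 1].

Definition locally_lipschitz (R : realType) (n : nat) (V : 'rV[R]_n -> R) :
    Prop :=
  forall x : 'rV[R]_n, exists2 U, nbhs x U &
    exists L : R, forall y z, U y -> U z -> `|V y - V z| <= L * enorm (y - z).

Definition bounded_below (R : realType) (n : nat) (V : 'rV[R]_n -> R) : Prop :=
  has_lbound (range V).

Definition coercive (R : realType) (n : nat) (V : 'rV[R]_n -> R) : Prop :=
  forall M : R, compact [set x | V x <= M].

(* The base point y ranges over full neighbourhoods of x (y = x included) and
   the step l over right neighbourhoods of 0. The value is taken in the extended
   reals, where the upper limit always exists. *)
Definition clarke_derivative (R : realType) (n : nat) (V : 'rV[R]_n -> R)
    (x d : 'rV[R]_n) : \bar R :=
  limf_esup
    (fun yl : 'rV[R]_n * R => ((V (yl.1 + yl.2 *: d) - V yl.1) / yl.2)%:E)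
    (filter_prod (nbhs x) (0 : R)^'+).

Definition clarke_subdifferential (R : realType) (n : nat) (V : 'rV[R]_n -> R)
    (x : 'rV[R]_n) : set 'rV[R]_n :=
  [set p | forall d, ((dotmul d p)%:E <= clarke_derivative V x d)%E].

Definition cyclically_dense (R : realType) (n : nat) (d : nat -> 'rV[R]_n) :
    Prop :=
  forall e : R, 0 < e -> exists N : nat, forall k : nat,
    @esphere R n `<=` \bigcup_(i in [set i | (k <= i < k + N)%N]) eball (d i) e.

Definition itoh_abe_eq (R : realType) (n : nat) (V : 'rV[R]_n -> R)
    (x d : 'rV[R]_n) (t b : R) : Prop :=
  b = - ((V (x - (t * b) *: d) - V x) / (t * b)).

(* A relation between x and its successor x', because the nonzero solution b
   need not be unique. *)
Definition itoh_abe_step (R : realType) (n : nat) (V : 'rV[R]_n -> R)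
    (d : 'rV[R]_n) (t : R) (x x' : 'rV[R]_n) : Prop :=
  (exists b : R,
     [/\ b != 0, itoh_abe_eq V x d t b & x' = x - (t * b) *: d]) \/
  (~ (exists b : R, b != 0 /\ itoh_abe_eq V x d t b) /\ x' = x).

Definition itoh_abe_iterates (R : realType) (n : nat) (V : 'rV[R]_n -> R)
    (x0 : 'rV[R]_n) (d : nat -> 'rV[R]_n) (tau : nat -> R)
    (x : nat -> 'rV[R]_n) : Prop :=
  x 0%N = x0 /\ forall k : nat, itoh_abe_step V (d k) (tau k) (x k) (x k.+1).

(* Main.v *)
Require Import Defs.
From HB Require Import structures.
From mathcomp Require Import all_boot all_order all_algebra.
From mathcomp Require Import all_classical all_reals all_analysis.
From mathcomp Require Import ring lra.

Set Implicit Arguments.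
Unset Strict Implicit.
Unset Printing Implicit Defensive.

Import Order.TTheory GRing.Theory Num.Theory.
Import numFieldNormedType.Exports.

Local Open Scope classical_set_scope.
Local Open Scope ring_scope.

(** Multiplying the defining equation of a step by its length turns it into an
energy identity: a displacement s *: d with step size t lowers V by exactly
s^2 / t ([itoh_abe_step_energy]).  As V is bounded below, the decreases
tend to 0, and so do the displacements, because t <= tau_max.

Suppose that the Clarke derivative at an accumulation point xstar is negative in
some direction v, which may be scaled to a unit vector u.  Unfolding the upper
limit, V decreases at a uniform linear rate eta along u, from all points near
xstar and for all short displacements; by the Lipschitz condition the same holds,
at a smaller rate, for all directions close to u ([uniform_descent_near]).
From a point near xstar, a step along such a direction cannot be small: linear
descent beats the quadratic term s^2 / t as long as 0 < s < eta * t, so a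
nonzero solution exists by the intermediate value theorem, and within the range
of the descent estimate no positive solution is shorter than eta * t, whereas a
short backward step would increase V ([itoh_abe_step_decrease]).

Cyclic density contradicts this.  Late enough, the iterates come close to xstar
and move so little that they stay close for N further steps, where N is the
length of a window in which some direction is close to u.  The step along that
direction is bounded away from 0, although all late steps are small.

Distances between iterates are measured in the sup norm `|x|.  It is at most the
Euclidean norm, in which the Lipschitz condition, the sphere and the covers are
given; this comparison spares the triangle inequality for the Euclidean norm. *)

(** * Euclidean norm and sup norm *)

Lemma enorm_ge0 (R : realType) (n : nat) (u : 'rV[R]_n) : 0 <= enorm u.
Proof. exact: sqrtr_ge0. Qed.

Lemma enormZ (R : realType) (n : nat) (a : R) (u : 'rV[R]_n) :
  enorm (a *: u) = `|a| * enorm u.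
Proof.
rewrite /enorm -sqrtr_sqr -sqrtrM ?sqr_ge0//; congr Num.sqrt.
by rewrite /dotmul mulr_sumr; apply: eq_bigr => i _; rewrite !mxE; ring.
Qed.

Lemma enorm_distC (R : realType) (n : nat) (u v : 'rV[R]_n) :
  enorm (u - v) = enorm (v - u).
Proof. by rewrite -opprB -scaleN1r enormZ normrN1 mul1r. Qed.

Lemma mx_norm_le_enorm (R : realType) (n : nat) (u : 'rV[R]_n) :
  `|u| <= enorm u.
Proof.
rewrite -[`|u|]/(mx_norm u) mx_normrE; apply: bigmax_le; first exact: enorm_ge0.
case=> i j _ /=; rewrite (ord1 i) -sqrtr_sqr; apply: ler_wsqrtr.
rewrite /dotmul (bigD1 j)//= expr2 lerDl.
by apply: sumr_ge0 => k _; rewrite -expr2 sqr_ge0.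
Qed.

Lemma enorm_le_mx_norm (R : realType) (n : nat) (u : 'rV[R]_n) :
  enorm u <= Num.sqrt n%:R * `|u|.
Proof.
rewrite -[`|u|]ger0_norm// -sqrtr_sqr -sqrtrM ?ler0n//; apply: ler_wsqrtr.
rewrite mulr_natl -[X in _ <= _ *+ X](card_ord n) -sumr_const.
apply: ler_sum => i _; rewrite -expr2 -real_normK ?num_real//.
rewrite lerXn2r ?nnegrE// -[`|u|]/(mx_norm u) mx_normrE.
exact: (le_bigmax _ (fun ij : 'I_1 * 'I_n => `|u ij.1 ij.2|) (0, i)).
Qed.

(** * Continuity of locally Lipschitz functions *)

Lemma nbhs_norm_lt (R : realType) (n : nat) (x : 'rV[R]_n) (e : R) :
  0 < e -> nbhs x [set y | `|x - y| < e].
Proof. by move=> e0; apply/(nbhs_normP x); exists e. Qed.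

Lemma locally_lipschitz_continuous (R : realType) (n : nat)
    (V : 'rV[R]_n -> R) : locally_lipschitz V -> continuous V.
Proof.
move=> hV; suff : forall x : 'rV[R]_n, V @ x --> V x by [].
move=> x; have [U Ux [L hL]] := hV x.
apply/(@cvgrPdist_lt _ _ _ (nbhs x) (nbhs_filter x)) => e e0.
pose C := `|L| * Num.sqrt n%:R + 1.
have C0 : 0 < C by rewrite ltr_wpDl// mulr_ge0// sqrtr_ge0.
have ball_x : nbhs x [set y | `|x - y| < e / C].
  by apply: nbhs_norm_lt; rewrite divr_gt0.
have Uxx := nbhs_singleton Ux; apply: filterS2 Ux ball_x => y Uy /= hy.
apply: (le_lt_trans (hL _ _ Uxx Uy)).
rewrite ltr_pdivlMr// in hy; apply: le_lt_trans hy.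
have h1 := enorm_le_mx_norm (x - y).
have h2 : L * enorm (x - y) <= `|L| * enorm (x - y).
  by rewrite ler_wpM2r ?enorm_ge0// ler_norm.
have h3 : `|L| * enorm (x - y) <= `|L| * (Num.sqrt n%:R * `|x - y|).
  by rewrite ler_wpM2l.
have h4 : 0 <= `|x - y| by [].
rewrite /C; lra.
Qed.

(** * Uniform linear descent *)

(** The quantitative content of a negative Clarke derivative at z: the same
linear rate serves all base points y near z, not only z itself.  The
iterates only come near z, so a rate at z alone would say nothing about them. *)
Definition uniform_descent (R : realType) (n : nat) (V : 'rV[R]_n -> R)
    (z d : 'rV[R]_n) (eta delta : R) : Prop :=
  forall y l, `|y - z| < delta -> 0 < l < delta ->
    V (y + l *: d) <= V y - eta * l.

(** The upper limit is an infimum, over sets of the filter, of suprema;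
one of those suprema is already negative, and its absolute value (or 1 if it
is infinite) serves as eta. *)
Lemma clarke_derivative_lt0_descent (R : realType) (n : nat)
    (V : 'rV[R]_n -> R) (z d : 'rV[R]_n) :
  (clarke_derivative V z d < 0)%E ->
  exists eta delta, [/\ 0 < eta, 0 < delta & uniform_descent V z d eta delta].
Proof.
rewrite /clarke_derivative /limf_esup => /ereal_inf_lt[_ [A FA <-]] supA.
have [eta eta0 supA_le] : exists2 eta : R, 0 < eta &
    (ereal_sup [set ((V (yl.1 + yl.2 *: d) - V yl.1) / yl.2)%:E | yl in A]
      <= (- eta)%:E)%E.
  move: supA; case: ereal_sup => [r||]//.
    by rewrite lte_fin => r0; exists (- r); rewrite ?oppr_gt0 ?opprK.
  by move=> _; exists 1; rewrite // leNye.
case: FA => -[B C] /= [/nbhs_normP[/= r1 r10 hB] /nbhs_normP[/= r2 r20 hC]] BC.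
exists eta, (Num.min r1 r2); split=> //; first by rewrite lt_min r10.
move=> y l; rewrite !lt_min => /andP[y1 _] /and3P[l0 _ l2].
have Ayl : A (y, l).
  apply: BC; split=> /=; first by apply: hB; rewrite /= distrC.
  by apply: hC => //=; rewrite sub0r normrN gtr0_norm.
have := le_trans (ereal_sup_ubound (imageP _ Ayl)) supA_le.
by rewrite lee_fin /= ler_pdivrMr//; lra.
Qed.

Lemma uniform_descentZ (R : realType) (n : nat) (V : 'rV[R]_n -> R)
    (z d : 'rV[R]_n) (eta delta c : R) : 0 < c ->
  uniform_descent V z d eta delta ->
  uniform_descent V z (c *: d) (eta * c) (Num.min delta (delta / c)).
Proof.
move=> c0 hV y l; rewrite !lt_min => /andP[yz _] /and3P[l0 _ lc].
rewrite scalerA -mulrA [c * l]mulrC; apply: hV => //.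
by rewrite mulr_gt0//= -ltr_pdivlMr.
Qed.

(** Replacing d by d' moves the end point of a displacement of length parameter
l by l * enorm (d' - d), so V changes by at most |L| * l * enorm (d' - d), which
is at most half of the guaranteed decrease eta * l once d' is close to d. *)
Lemma uniform_descent_near (R : realType) (n : nat) (V : 'rV[R]_n -> R)
    (z d : 'rV[R]_n) (eta delta : R) :
  locally_lipschitz V -> 0 < eta -> 0 < delta ->
  uniform_descent V z d eta delta ->
  exists e eta' delta', [/\ 0 < e, 0 < eta', 0 < delta' &
    forall d', eball d e d' -> uniform_descent V z d' eta' delta'].
Proof.
move=> hlip eta0 delta0 hV.
have [U /nbhs_normP[/= r r0 hU] [L hL]] := hlip z.
pose M := `|L| + 1; have M0 : 0 < M by rewrite ltr_wpDl.
(* At distance e from d, the Lipschitz error M * (l * e) is eta / 2 * l. *)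
pose e := eta / (2 * M); have e0 : 0 < e by rewrite divr_gt0// mulr_gt0.
(* K bounds the norms of d and of every d' under consideration; l * K < r / 2
   keeps both end points in the domain of the Lipschitz estimate. *)
pose K := `|d| + e; have K0 : 0 < K by rewrite ltr_wpDl.
exists e, (eta / 2), (Num.min delta (Num.min (r / 2) (r / (2 * K)))).
split=> //; first by rewrite divr_gt0.
  by rewrite !lt_min delta0 !divr_gt0// mulr_gt0.
move=> d' dd' y l.
rewrite !lt_min => /and3P[yd yr _] /andP[l0 /and3P[ld _ lK]].
have lK' : l * K < r / 2.
  have -> : r / 2 = r / (2 * K) * K by field; rewrite gt_eqF.
  by rewrite ltr_pM2r.
have d'd : `|d' - d| < e := le_lt_trans (mx_norm_le_enorm _) dd'.
have Uw w : `|w| <= K -> U (y + l *: w).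
  move=> wK; apply: hU => /=; rewrite distrC.
  have -> : y + l *: w - z = (y - z) + l *: w by rewrite addrAC.
  apply: (le_lt_trans (ler_normD _ _)); rewrite normrZ gtr0_norm//.
  have : l * `|w| <= l * K by rewrite ler_wpM2l// ltW.
  lra.
have Ud' : U (y + l *: d').
  apply: Uw; rewrite -(subrK d d'); apply: (le_trans (ler_normD _ _)).
  by rewrite /K addrC lerD2l ltW.
have Ud : U (y + l *: d) by apply: Uw; rewrite lerDl ltW.
have h1 : V (y + l *: d) <= V y - eta * l by apply: hV => //; rewrite l0.
have := hL _ _ Ud' Ud.
have -> : y + l *: d' - (y + l *: d) = l *: (d' - d).
  by rewrite opprD addrACA subrr add0r scalerBr.
rewrite enormZ (gtr0_norm l0) => h2.
have h3 : L * (l * enorm (d' - d)) <= M * (l * e).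
  have hM : L * (l * enorm (d' - d)) <= M * (l * enorm (d' - d)).
    apply: ler_wpM2r; first by rewrite mulr_ge0 ?enorm_ge0 ?ltW.
    by rewrite (le_trans (ler_norm L))// lerDl.
  by apply: (le_trans hM); rewrite ler_pM2l// ler_pM2l// ltW.
have h4 : M * (l * e) = eta / 2 * l by rewrite /e; field; rewrite gt_eqF.
have := ler_norm (V (y + l *: d') - V (y + l *: d)); lra.
Qed.

(** * Itoh-Abe steps *)

(** The displacement s stands for - t * b, so that s = 0 can only come from the
case in which the equation has no nonzero solution. *)
Lemma itoh_abe_step_energy (R : realType) (n : nat) (V : 'rV[R]_n -> R)
    (d : 'rV[R]_n) (t : R) (x x' : 'rV[R]_n) :
  0 < t -> itoh_abe_step V d t x x' ->
  exists s, [/\ x' = x + s *: d, V x' = V x - s ^+ 2 / t &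
    s = 0 -> ~ exists b, b != 0 /\ itoh_abe_eq V x d t b].
Proof.
move=> t0 [[b [b0 hb ->]]|[nosol ->]]; last first.
  by exists 0; split=> //; rewrite ?scale0r ?addr0 ?expr0n ?mul0r ?subr0.
have tb0 : t * b != 0 by rewrite mulf_neq0// gt_eqF.
exists (- (t * b)); split; first by rewrite scaleNr.
  have energy : b * (t * b) = - (V (x - (t * b) *: d) - V x).
    by rewrite {1}hb mulNr divfK.
  have -> : (- (t * b)) ^+ 2 / t = b * (t * b) by field; rewrite gt_eqF.
  by rewrite energy; ring.
by move/eqP; rewrite oppr_eq0 (negbTE tb0).
Qed.

(** The function r |-> V (x + r d) - V x + r^2 / t is negative at s and tends to
infinity with r, because V is bounded below; a zero beyond s is a displacement
that solves the Itoh-Abe equation. *)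
Lemma itoh_abe_solvable (R : realType) (n : nat) (V : 'rV[R]_n -> R)
    (d x : 'rV[R]_n) (t s : R) :
  continuous V -> bounded_below V -> 0 < t -> 0 < s ->
  V (x + s *: d) < V x - s ^+ 2 / t ->
  exists b, b != 0 /\ itoh_abe_eq V x d t b.
Proof.
move=> Vcont [m hm] t0 s0 Vs.
have Vm y : m <= V y by apply: hm; exists y.
pose F r := V (x + r *: d) - V x + r ^+ 2 / t.
(* The summand 1 makes T >= 1, hence T^2 >= T >= t * (V x - m). *)
pose T := s + 1 + t * (V x - m).
have h0 : 0 <= t * (V x - m) by rewrite mulr_ge0 ?subr_ge0// ltW.
have sT : s <= T by rewrite /T; lra.
have Fs : F s <= 0 by rewrite /F; lra.
have FT : 0 <= F T.
  have hT : V x - m <= T ^+ 2 / t.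
    by rewrite ler_pdivlMr// mulrC /T; nra.
  have := Vm (x + T *: d); rewrite /F; lra.
have Fcont : continuous F.
  move=> r; apply: cvgD; last by apply: cvgMl; exact: exprn_continuous.
  apply: cvgB; last exact: cvg_cst.
  apply: (@cvg_comp _ _ _ (fun r => x + r *: d) V _ _ _ _ (Vcont _)).
  by apply: cvgD; [exact: cvg_cst | apply: cvgZ; [exact: cvg_id | exact: cvg_cst]].
have [c + Fc0] : exists2 c, c \in `[s, T] & F c = 0.
  apply: IVT => //; first exact: continuous_subspaceT.
  by rewrite ge_min Fs le_max FT orbT.
rewrite in_itv/= => /andP[sc _].
have c0 : 0 < c := lt_le_trans s0 sc.
exists (- (c / t)); split; first by rewrite oppr_eq0 gt_eqF// divr_gt0.
rewrite /itoh_abe_eq mulrN mulrCA divff ?gt_eqF// mulr1 scaleNr opprK.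
have -> : V (x + c *: d) - V x = - (c ^+ 2 / t) by move: Fc0; rewrite /F; lra.
by field; rewrite !gt_eqF.
Qed.

(** The displacement s satisfies |s| >= min (delta / 2) (eta * t).  Otherwise
the descent estimate applies to it.  If s > 0, it gives s^2 / t >= eta * s, too
large for s < eta * t.  If s < 0, it applies at x', from which x is reached in
the direction +d, and gives V x < V x' against the energy identity.  If s = 0,
the descent along d makes the equation solvable. *)
Lemma itoh_abe_step_decrease (R : realType) (n : nat) (V : 'rV[R]_n -> R)
    (z d x x' : 'rV[R]_n) (eta delta t : R) :
  continuous V -> bounded_below V -> 0 < eta -> 0 < delta ->
  uniform_descent V z d eta delta -> `|d| <= 1 -> `|x - z| < delta / 2 ->
  0 < t -> itoh_abe_step V d t x x' ->
  Num.min (delta / 2) (eta * t) ^+ 2 / t <= V x - V x'.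
Proof.
move=> Vcont Vbelow eta0 delta0 hV d1 xz t0 step.
have [s [x's Vx' nosol]] := itoh_abe_step_energy t0 step.
have -> : V x - V x' = s ^+ 2 / t by rewrite Vx'; ring.
rewrite ler_pM2r ?invr_gt0// -[s ^+ 2]real_normK ?num_real//.
set c := Num.min _ _.
have c0 : 0 < c by rewrite lt_min divr_gt0//= mulr_gt0.
rewrite lerXn2r ?nnegrE ?(ltW c0)// leNgt; apply/negP => sc.
have /andP[s_delta s_eta] : (`|s| < delta / 2) && (`|s| < eta * t).
  by rewrite -lt_min.
have s2 : s ^+ 2 / t < eta * `|s| \/ s = 0.
  have [->|s_neq0] := eqVneq s 0; [by right | left].
  rewrite ltr_pdivrMr// -[s ^+ 2]real_normK ?num_real// expr2 mulrAC.
  by rewrite ltr_pM2r// normr_gt0.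
have [s0|s0|s0] := ltgtP s 0.
- have xs_z : `|x' - z| < delta.
    rewrite x's addrAC; apply: (le_lt_trans (ler_normD _ _)).
    rewrite normrZ; have : `|s| * `|d| <= `|s| by rewrite ler_piMr.
    lra.
  have hs : 0 < - s < delta by rewrite oppr_gt0 s0 -ltr0_norm//; lra.
  have := hV _ _ xs_z hs.
  have -> : x' + - s *: d = x by rewrite x's scaleNr addrK.
  have : 0 < eta * - s by rewrite mulr_gt0 ?oppr_gt0.
  have : 0 <= s ^+ 2 / t by rewrite divr_ge0 ?sqr_ge0 ?ltW.
  lra.
- have xz' : `|x - z| < delta by lra.
  have hs : 0 < s < delta by rewrite s0 -(gtr0_norm s0); lra.
  have := hV _ _ xz' hs; rewrite -x's Vx'.
  by case: s2 => [|s2]; [rewrite gtr0_norm//; lra | rewrite s2 ltxx in s0].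
(* Any displacement in the range of the descent estimate and below eta * t
   witnesses solvability. *)
- apply: (nosol s0); pose r := c / 2.
  have r0 : 0 < r by rewrite divr_gt0.
  have rc : r < c by rewrite /r; lra.
  move: rc; rewrite lt_min => /andP[r_delta r_eta].
  apply: (itoh_abe_solvable Vcont Vbelow t0 r0).
  have xz' : `|x - z| < delta by lra.
  have hr : 0 < r < delta by rewrite r0; lra.
  apply: (le_lt_trans (hV _ _ xz' hr)); rewrite ltrD2l ltrN2.
  by rewrite ltr_pdivrMr// expr2 [ltRHS]mulrAC ltr_pM2r.
Qed.

(** * Smallness of late steps *)

Lemma nonincreasing_bounded_gap_lt (R : realType) (u : nat -> R) (e : R) :
  nonincreasing_seq u -> has_lbound (range u) -> 0 < e ->
  exists K, forall k, (K <= k)%N -> u k - u k.+1 < e.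
Proof.
move=> u_dec u_lb e0.
have hinf : has_inf (range u) by split; first by exists (u 0%N); exists 0%N.
have [_ [K _ <-] uK] := inf_adherent e0 hinf.
exists K => k Kk; have := u_dec _ _ Kk.
have : inf (range u) <= u k.+1 by apply: ge_inf => //; exists k.+1.
lra.
Qed.

Lemma dist_le_sum_steps (R : realType) (n : nat) (x : nat -> 'rV[R]_n)
    (r : R) (k : nat) :
  (forall i, (k <= i)%N -> `|x i.+1 - x i| <= r) ->
  forall j, `|x (k + j)%N - x k| <= j%:R * r.
Proof.
move=> hx; elim=> [|j IH]; first by rewrite addn0 subrr normr0 mul0r.
have := hx _ (leq_addr j k); rewrite -addnS -natr1 mulrDl mul1r => h.
have -> : x (k + j.+1)%N - x k =
    (x (k + j)%N - x k) + (x (k + j.+1)%N - x (k + j)%N).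
  by rewrite [RHS]addrC addrA subrK.
by rewrite (le_trans (ler_normD _ _))// lerD.
Qed.

(** * Stationarity of accumulation points *)

Theorem theorem3p9 (R : realType) (n : nat) (V : 'rV[R]_n -> R)
    (hVlip : locally_lipschitz V)
    (hVbelow : bounded_below V)
    (hVcoer : coercive V)
    (tau_min tau_max : R) (htau_min : 0 < tau_min)
    (htau_max : tau_min <= tau_max)
    (tau : nat -> R) (htau : forall k : nat, tau_min <= tau k <= tau_max)
    (d : nat -> 'rV[R]_n) (hd : forall k : nat, esphere (d k))
    (hdense : cyclically_dense d)
    (x0 : 'rV[R]_n) (x : nat -> 'rV[R]_n)
    (hx : itoh_abe_iterates V x0 d tau x)
    (xstar : 'rV[R]_n) (hxstar : cluster (x @ \oo) xstar) :
  clarke_subdifferential V xstar 0.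
Proof.
case: hx => _ step.
have Vcont := locally_lipschitz_continuous hVlip.
have tau_gt0 k : 0 < tau k.
  by have /andP[h _] := htau k; exact: lt_le_trans htau_min h.
have tau_max0 : 0 < tau_max := lt_le_trans htau_min htau_max.
move=> v; have -> : dotmul v 0 = 0.
  by rewrite /dotmul big1// => i _; rewrite mxE mulr0.
rewrite leNgt; apply/negP => Vv.
have [eta0 [delta0 [eta0_gt0 delta0_gt0 descent_v]]] :=
  clarke_derivative_lt0_descent Vv.
have v_gt0 : 0 < enorm v.
  (* For v = 0 the descent inequality would read V xstar < V xstar. *)
  rewrite lt_neqAle enorm_ge0 andbT eq_sym; apply/eqP => v0.
  have v_eq0 : v = 0.
    by apply/eqP; rewrite -normr_le0 -v0 mx_norm_le_enorm.
  have := descent_v xstar (delta0 / 2).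
  rewrite subrr normr0 v_eq0 scaler0 addr0 => /(_ delta0_gt0).
  have : 0 < eta0 * (delta0 / 2) by rewrite mulr_gt0 ?divr_gt0.
  have h : 0 < delta0 / 2 < delta0 by lra.
  by move=> h' /(_ h); lra.
pose c := (enorm v)^-1; have c_gt0 : 0 < c by rewrite invr_gt0.
have u_sphere : esphere (c *: v).
  by rewrite /esphere/= enormZ gtr0_norm// mulVf ?gt_eqF.
have descent_u := uniform_descentZ c_gt0 descent_v.
have [|| e [eta [delta [e_gt0 eta_gt0 delta_gt0 descent]]]] :=
  uniform_descent_near hVlip _ _ descent_u.
- by rewrite mulr_gt0.
- by rewrite lt_min delta0_gt0 divr_gt0.
have [N cover] := hdense _ e_gt0.
(* N + 1 steps of length r cover a quarter of delta. *)
pose r := delta / (4 * N.+1%:R).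
have r_gt0 : 0 < r by rewrite divr_gt0// mulr_gt0.
(* A step near xstar along a direction close to c *: v lowers V by at least
   gap, whatever its step size in [tau_min, tau_max]. *)
pose gap := Num.min (delta / 2) (eta * tau_min) ^+ 2 / tau_max.
have gap_gt0 : 0 < gap.
  by rewrite divr_gt0// exprn_gt0// lt_min divr_gt0//= mulr_gt0.
have [K smallK] : exists K, forall k, (K <= k)%N ->
    V (x k) - V (x k.+1) < Num.min gap (r ^+ 2 / tau_max).
  apply: (@nonincreasing_bounded_gap_lt _ (V \o x)).
  - apply/nonincreasing_seqP => k /=.
    have [s [_ -> _]] := itoh_abe_step_energy (tau_gt0 k) (step k).
    by rewrite gerBl divr_ge0 ?sqr_ge0 ?ltW.
  - by have [m hm] := hVbelow; exists m => _ [k _ <-]; apply: hm; exists (x k).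
  - by rewrite lt_min gap_gt0 divr_gt0// exprn_gt0.
have norm_d k : `|d k| <= 1 by rewrite -(hd k) mx_norm_le_enorm.
have small_step k : (K <= k)%N -> `|x k.+1 - x k| <= r.
  move=> Kk; have := smallK k Kk; rewrite lt_min => /andP[_].
  have [s [-> -> _]] := itoh_abe_step_energy (tau_gt0 k) (step k).
  have /andP[_ tk] := htau k.
  rewrite subKr addrC addKr normrZ => hs.
  have sd : `|s| * `|d k| <= `|s| by rewrite ler_piMr.
  apply: (le_trans sd); rewrite -ler_sqr ?nnegrE ?(ltW r_gt0)//.
  rewrite real_normK ?num_real//.
  have : s ^+ 2 / tau_max <= s ^+ 2 / tau k.
    by rewrite ler_wpM2l ?sqr_ge0// lef_pV2 ?posrE.
  move/le_lt_trans => /(_ _ hs).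
  by rewrite ltr_pM2r ?invr_gt0// => /ltW.
have [k [Kk xk]] : exists k, (K <= k)%N /\ `|xstar - x k| < delta / 4.
  have tailK : (x @ \oo) (x @` [set k | (K <= k)%N]).
    by exists K => // k /= Kk; exists k.
  have delta4 : 0 < delta / 4 by rewrite divr_gt0.
  have [_ [[k Kk <-] xk]] := hxstar _ _ tailK (nbhs_norm_lt xstar delta4).
  by exists k.
have [i /andP[ki ikN] di] := cover k _ u_sphere.
have descent_di : uniform_descent V xstar (d i) eta delta.
  by apply: descent; rewrite /eball/= enorm_distC.
have xi : `|x i - xstar| < delta / 2.
  have := dist_le_sum_steps (fun j kj => small_step j (leq_trans Kk kj)) (i - k).
  rewrite subnKC// => hi.
  have : (i - k)%:R * r <= delta / 4.
    have -> : delta / 4 = N.+1%:R * r.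
      have : N.+1%:R != 0 :> R by [].
      by rewrite /r; move: N.+1%:R => m m0; field.
    by rewrite ler_pM2r// ler_nat leq_subLR addnS leqW// ltnW.
  have := ler_normD (x i - x k) (x k - xstar).
  rewrite addrA subrK [`|x k - xstar|]distrC; lra.
have Ki : (K <= i)%N := leq_trans Kk ki.
have := smallK i Ki; rewrite lt_min => /andP[+ _]; apply/negP; rewrite -leNgt.
apply: le_trans (itoh_abe_step_decrease Vcont hVbelow eta_gt0 delta_gt0
  descent_di (norm_d i) xi (tau_gt0 i) (step i)).
have /andP[tmin tmax] := htau i.
have min_ge0 t : 0 <= t -> 0 <= Num.min (delta / 2) (eta * t).
  by move=> t0; rewrite le_min divr_ge0 ?(ltW delta_gt0)//= mulr_ge0// ltW.
apply: ler_pM; rewrite ?sqr_ge0 ?invr_ge0 ?(ltW tau_max0)//; last first.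
  by rewrite lef_pV2 ?posrE.
rewrite lerXn2r ?nnegrE ?min_ge0 ?(ltW htau_min) ?(ltW (tau_gt0 i))//.
by rewrite le_min ge_min lexx/= ge_min (ler_pM2l eta_gt0) tmin orbT.
Qed.
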